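(* For every connected graph $G$ the following assertions are equivalent: (i) $G$ is countably determined. (ii) $G$ contains a countable normal tree that contains a ray from every end of $G$.
   Context: Graphs may be infinite of any cardinality. Countable means finite or countably infinite. A ray is a one-way infinite path. Two rays in $G$ are equivalent if no finite set of vertices separates them; the equivalence classes are the ends of $G$. A direction of $G$ is a map $f$ that assigns to every finite set $X\subseteq V(G)$ a component $f(X)$ of $G-X$ such that $f(X)\supseteq f(X')$ whenever $X\subseteq X'$. A directional choice in $G$ is a pair $(X,C)$ of a finite set $X\subseteq V(G)$ and a component $C$ of $G-X$. It distinguishes a direction $f$ from another direction $h$ if $f(X)=C$ and $h(X)\neq C$. The graph $G$ is countably determined if there is a countable set of directional choices in $G$ that distinguish every two directions of $G$ from each other (i.e. for any two distinct directions $f,h$, some directional choice in the set distinguishes $f$ from $h$). The tree-order of a rooted tree $(T,r)$ is given by $u\le v$ if $u$ lies on the path $rTv$ in $T$. A rooted tree $T\subseteq G$ is normal in $G$ if the endvertices of every $T$-path in $G$ are comparable in the tree-order of $T$, where a $T$-path in $G$ is a non-trivial path that meets $T$ exactly in its endvertices. A normal tree need not be spanning. *)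

(* Defs.v *)
From mathcomp Require Import all_boot.
From mathcomp Require Import boolp classical_sets functions cardinality.
Set Implicit Arguments.
Unset Strict Implicit.
Unset Printing Implicit Defensive.
Local Open Scope classical_set_scope.

(* The vertices form a subset of an ambient type V, so that a graph, its
   subgraphs and its vertex deletions all have type [graph V]. *)
Record graph (V : Type) : Type := Graph {
  vset : set V;
  adj : V -> V -> Prop;
  adj_sym : forall u v, adj u v -> adj v u;
  adj_irrefl : forall v, ~ adj v v;
  adj_vset : forall u v, adj u v -> vset u }.

(* The remaining fields are proofs, so equality of graphs is extensional. *)
Lemma graph_eq (V : Type) (G H : graph V) :
  vset G = vset H -> (forall u v, adj G u v <-> adj H u v) -> G = H.
Proof.
case: G => VG EG sG iG vG; case: H => VH EH sH iH vH /= eqV eqE.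
have eqEE : EG = EH by apply/funext => u; apply/funext => v; apply/propext.
subst VH EH; congr Graph; exact: Prop_irrelevance.
Qed.

Section Graphs.
Variable V : Type.
Implicit Types (G H C T : graph V) (A B X : set V) (p q r : nat -> V).

Definition subgraph H G : Prop :=
  vset H `<=` vset G /\ (forall u v, adj H u v -> adj G u v).

Definition delete_adj G X (u v : V) : Prop := [/\ adj G u v, ~ X u & ~ X v].

Fact delete_sym G X u v : delete_adj G X u v -> delete_adj G X v u.
Proof. by case=> uv Xu Xv; split=> //; apply: adj_sym. Qed.

Fact delete_irrefl G X v : ~ delete_adj G X v v.
Proof. by case=> vv _ _; apply: adj_irrefl vv. Qed.

Fact delete_vset G X u v : delete_adj G X u v -> (vset G `\` X) u.
Proof. by case=> uv Xu _; split=> //; apply: adj_vset uv. Qed.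

Definition delete G X : graph V :=
  Graph (@delete_sym G X) (@delete_irrefl G X) (@delete_vset G X).

(* The path p 0, ..., p n of length n; the values p i with n < i are
   irrelevant. *)
Definition is_path G p (n : nat) : Prop :=
  [/\ forall i, i <= n -> vset G (p i),
      forall i j, i <= n -> j <= n -> p i = p j -> i = j
    & forall i, i < n -> adj G (p i) (p i.+1)].

(* The empty graph is not connected. *)
Definition connected G : Prop :=
  vset G !=set0 /\
  (forall u v, vset G u -> vset G v ->
     exists p n, [/\ is_path G p n, p 0 = u & p n = v]).

Definition component G C : Prop :=
  [/\ subgraph C G, connected C
    & forall C', subgraph C' G -> connected C' -> subgraph C C' -> C' = C].

(* The path p 0, ..., p n closed up by an edge, of length n.+1 >= 3. *)
Definition is_cycle G p (n : nat) : Prop :=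
  [/\ 2 <= n, is_path G p n & adj G (p n) (p 0)].

Definition acyclic G : Prop := forall p n, ~ is_cycle G p n.

Definition is_tree T : Prop := connected T /\ acyclic T.

(* A ray has exactly one vertex of degree 1, so it is determined by the
   enumeration of its vertices starting there. *)
Definition is_ray G r : Prop :=
  (forall i j, r i = r j -> i = j) /\ (forall i, adj G (r i) (r i.+1)).

Record finvset G : Type := FinVSet {
  fset_of :> set V;
  _ : finite_set fset_of;
  _ : fset_of `<=` vset G }.

(* A path from A to B that meets A only in its first vertex and B only in its
   last; it may be trivial. *)
Definition is_AB_path G A B p (n : nat) : Prop :=
  [/\ is_path G p n,
      forall i, i <= n -> (A (p i) <-> i = 0)
    & forall i, i <= n -> (B (p i) <-> i = n)].

Definition separates G X A B : Prop :=
  forall p n, is_AB_path G A B p n -> exists2 i, i <= n & X (p i).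

Definition ray_equiv G r q : Prop :=
  forall X : finvset G, ~ separates G X (range r) (range q).

Definition is_end G (w : set (nat -> V)) : Prop :=
  exists2 r, is_ray G r & w = [set q | is_ray G q /\ ray_equiv G r q].

Definition is_direction G (f : finvset G -> graph V) : Prop :=
  (forall X : finvset G, component (delete G X) (f X)) /\
  (forall X X' : finvset G, X `<=` X' -> subgraph (f X') (f X)).

Definition directional_choice G (c : finvset G * graph V) : Prop :=
  component (delete G c.1) c.2.

Definition distinguishes G (c : finvset G * graph V)
    (f h : finvset G -> graph V) : Prop :=
  f c.1 = c.2 /\ h c.1 <> c.2.

Definition countably_determined G : Prop :=
  exists D : set (finvset G * graph V),
    [/\ countable D,
        forall c, D c -> directional_choice c
      & forall f h, is_direction f -> is_direction h -> f <> h ->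
          exists2 c, D c & distinguishes c f h].

Definition is_rooted_tree T (r : V) : Prop := is_tree T /\ vset T r.

(* In a tree the path p from r to v is unique. *)
Definition tree_le T (r u v : V) : Prop :=
  exists p n, [/\ is_path T p n, p 0 = r, p n = v & exists2 i, i <= n & p i = u].

(* The last clause matters only for n = 1: the intersection of the path and T
   contains no edge. *)
Definition is_Tpath G T p (n : nat) : Prop :=
  [/\ is_path G p n, 0 < n,
      forall i, i <= n -> (vset T (p i) <-> i = 0 \/ i = n)
    & forall i, i < n -> ~ adj T (p i) (p i.+1)].

Definition is_normal_tree G T (r : V) : Prop :=
  [/\ is_rooted_tree T r, subgraph T G
    & forall p n, is_Tpath G T p n ->
        tree_le T r (p 0) (p n) \/ tree_le T r (p n) (p 0)].

End Graphs.

(* Main.v *)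
(* From (ii) to (i): let T be the normal tree and D the set of all (down t, C) with
   t in T and C a component of G - down t meeting T. For a direction f,
   every f X contains a ray, so it meets T, as X does not separate this ray from
   a ray of T. If f X <> h X, let Y consist of the root and the down-closure in T
   of the vertices of X in T, and take vertices v in f (X + Y) and w in h (X + Y)
   of T. Let s be the last vertex of Y on the path of T from the root to v. If f
   and h agreed at down s, then by normality v and w would lie above a common
   vertex outside Y and be joined in T above it, hence avoiding X.

   From (i) to (ii): every countable set of vertices lies in a countable normal
   tree, built depth first. Take such a tree T0 containing the sets X of all the
   given choices. If f meets T0 outside every finite subset of T0, then T0
   contains a ray with direction f. There are only countably many other
   directions f: for a minimal finite X in T0 with f X disjoint from T0, any two
   directions that share X as well are distinguished by a choice with component
   f X. So T0 together with one ray for each of these is countable, and a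
   countable normal tree containing it is as required. *)
Require Import Defs.
From mathcomp Require Import all_boot.
From mathcomp Require Import boolp classical_sets functions cardinality.
From mathcomp Require Import zify.
Set Implicit Arguments.
Unset Strict Implicit.
Unset Printing Implicit Defensive.
Local Open Scope classical_set_scope.

(** * Least elements, injectivity and bounds over the naturals *)

Lemma least_nat (P : nat -> Prop) :
  (exists n, P n) -> exists n, P n /\ forall m, P m -> n <= m.
Proof.
case=> n; elim/ltn_ind: n => n IH Pn.
have [[m [Pm mn]]|none] := pselect (exists m, P m /\ m < n); first exact: IH mn Pm.
by exists n; split=> // m Pm; rewrite leqNgt; apply/negP => mn; apply: none; exists m.
Qed.

Lemma increasing_inj (A : Type) (p : nat -> A) :
  (forall i j, i < j -> p i <> p j) -> forall i j, p i = p j -> i = j.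
Proof.
move=> lt_ij i j e; case: (ltngtP i j) => // ij.
- by case: (lt_ij _ _ ij).
- by case: (lt_ij _ _ ij).
Qed.

Lemma finite_nat_bound (A : set nat) : finite_set A -> exists N, forall n, A n -> n < N.
Proof.
move=> /finite_seqP[s ->]; exists (\max_(i <- s) i).+1 => n ns.
by rewrite ltnS; apply: leq_bigmax_seq.
Qed.

(** * Walks and components *)

Section Walks.
Variables (V : Type).
Implicit Types (G H C T : graph V) (A B X : set V) (p q r : nat -> V).

Fixpoint walk H (n : nat) (u v : V) : Prop :=
  if n is m.+1 then exists2 w, adj H u w & walk H m w v
  else vset H u /\ u = v.

Definition linked H (u v : V) : Prop := exists n, walk H n u v.

Lemma adj_vsetr H u v : adj H u v -> vset H v.
Proof. by move=> uv; apply: adj_vset (adj_sym uv). Qed.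

Lemma walk_cat H m n u v w : walk H m u v -> walk H n v w -> walk H (m + n) u w.
Proof.
elim: m u => [|m IH] u /=; first by case=> _ ->.
by case=> x ux xv vw; exists x => //; apply: IH.
Qed.

Lemma walk_vset H n u v : walk H n u v -> vset H u /\ vset H v.
Proof.
elim: n u => [|n IH] u /=; first by case=> Hu <-.
by case=> w uw /IH[_ Hv]; split=> //; apply: adj_vset uw.
Qed.

Lemma adj_walk H u v : adj H u v -> walk H 1 u v.
Proof. by move=> uv; exists v => //; split=> //; apply: adj_vsetr uv. Qed.

Lemma walk_sym H n u v : walk H n u v -> walk H n v u.
Proof.
elim: n u => [|n IH] u /=; first by case=> Hu <-.
case=> w uw /IH vw; rewrite -/(walk H n.+1 v u) -addn1.
by apply: walk_cat vw _; apply/adj_walk/adj_sym.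
Qed.

Lemma walk_mono H H' n u v : subgraph H H' -> walk H n u v -> walk H' n u v.
Proof.
case=> sV sE; elim: n u => [|n IH] u /=; first by case=> /sV.
by case=> w /sE uw /IH; exists w.
Qed.

Lemma linked_refl H u : vset H u -> linked H u u.
Proof. by exists 0. Qed.

Lemma linked_sym H u v : linked H u v -> linked H v u.
Proof. by case=> n /walk_sym; exists n. Qed.

Lemma linked_trans H v u w : linked H u v -> linked H v w -> linked H u w.
Proof. by case=> m uv [n vw]; exists (m + n); apply: walk_cat uv vw. Qed.

Lemma linked_adj H u v : adj H u v -> linked H u v.
Proof. by move/adj_walk; exists 1. Qed.

Lemma linked_vset H u v : linked H u v -> vset H u /\ vset H v.
Proof. by case=> n /walk_vset. Qed.

Lemma linked_mono H H' u v : subgraph H H' -> linked H u v -> linked H' u v.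
Proof. by move=> sH [n uv]; exists n; apply: walk_mono uv. Qed.

Lemma walk_segment H p n : vset H (p n) ->
  (forall i, i < n -> adj H (p i) (p i.+1)) ->
  forall i j, i <= j -> j <= n -> walk H (j - i) (p i) (p j).
Proof.
move=> Hn Hp; have Hv k : k <= n -> vset H (p k).
  rewrite leq_eqVlt => /orP[/eqP->//|kn]; by apply: adj_vset (Hp _ kn).
move=> i j ij; rewrite -(subnKC ij) addKn.
move: (j - i) => k {j ij}; elim: k i => [|k IH] i jn /=.
  by rewrite addn0 in jn *; split=> //; apply: Hv.
exists (p i.+1); first by apply: Hp; lia.
by rewrite -addSnnS; apply: IH; lia.
Qed.

Lemma path_walk H p n i j :
  is_path H p n -> i <= j -> j <= n -> walk H (j - i) (p i) (p j).
Proof. by case=> Hv _ He; apply: walk_segment => //; apply: Hv. Qed.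

Lemma walk_fun H n u v : walk H n u v ->
  exists p, [/\ p 0 = u, p n = v & forall i, i < n -> adj H (p i) (p i.+1)].
Proof.
elim: n u => [|n IH] u /=; first by case=> _ <-; exists (fun=> u).
case=> w uw /IH[p [p0 pn ad]].
exists (fun i => if i is j.+1 then p j else u); split=> //.
by case=> [_|i]; [rewrite p0 | apply: ad].
Qed.

(** A repeated vertex, a later visit to [A] or an earlier visit to [B] would allow a shorter walk
    from [A] to [B]. *)
Lemma minimal_walk_path H A B n u v : walk H n u v -> A u -> B v ->
  (forall m a b, walk H m a b -> A a -> B b -> n <= m) ->
  exists p, [/\ is_AB_path H A B p n, p 0 = u & p n = v].
Proof.
move=> w Au Bv nmin; have [p [p0 pn ad]] := walk_fun w.
have seg : forall i j, i <= j -> j <= n -> walk H (j - i) (p i) (p j).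
  by apply: walk_segment; rewrite // pn; case: (walk_vset w).
exists p; split=> //; split; [split=> //| |].
- by move=> i i_n; case: (walk_vset (seg i i (leqnn i) i_n)).
- suff lt_ij : forall i j, i < j -> j <= n -> p i <> p j.
    move=> i j i_n j_n e; case: (ltngtP i j) => // ij.
    + by case: (lt_ij _ _ ij j_n).
    + by case: (lt_ij _ _ ij i_n).
  move=> i j ij jn e.
  have wi := seg 0 i (leq0n i) (leq_trans (ltnW ij) jn).
  have wj := seg j n jn (leqnn n).
  rewrite -e in wj; move: (walk_cat wi wj); rewrite p0 pn => /nmin/(_ Au Bv).
  lia.
- move=> i i_n; split=> [Ai|->]; last by rewrite p0.
  have := nmin _ _ _ (seg i n i_n (leqnn n)) Ai; rewrite pn => /(_ Bv); lia.
- move=> i i_n; split=> [Bi|->]; last by rewrite pn.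
  have := nmin _ _ _ (seg 0 i (leq0n i) i_n); rewrite p0 => /(_ Au Bi); lia.
Qed.

Lemma linked_AB_path H A B u v : linked H u v -> A u -> B v ->
  exists p n, is_AB_path H A B p n.
Proof.
case=> k w Au Bv.
have [|n [[a [b [ab Aa Bb]]] nmin]] := @least_nat
    (fun n => exists a b, [/\ walk H n a b, A a & B b]); first by exists k, u, v.
have [|p [Hp _ _]] := minimal_walk_path ab Aa Bb; last by exists p, n.
by move=> m a' b' wab Aa' Bb'; apply: nmin; exists a', b'.
Qed.

Lemma linked_path H u v : linked H u v ->
  exists p n, [/\ is_path H p n, p 0 = u & p n = v].
Proof.
case=> k w.
have [|n [uv nmin]] := @least_nat (fun n => walk H n u v); first by exists k.
have [|p [[Hp _ _] p0 pn]] :=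
    @minimal_walk_path H [set u] [set v] _ _ _ uv erefl erefl; last by exists p, n.
by move=> m _ _ /[swap]-> /[swap]->; apply: nmin.
Qed.

Lemma connected_linked H u v : connected H -> vset H u -> vset H v -> linked H u v.
Proof.
case=> _ cH Hu Hv; have [p [n [pp <- <-]]] := cH u v Hu Hv.
by exists n; have := path_walk pp (leq0n n) (leqnn n); rewrite subn0.
Qed.

Lemma linked_connected H : vset H !=set0 ->
  (forall u v, vset H u -> vset H v -> linked H u v) -> connected H.
Proof. by move=> H0 cH; split=> // u v Hu Hv; apply/linked_path/cH. Qed.

Lemma linked_closed H (P : V -> Prop) u v : linked H u v -> P u ->
  (forall x y, adj H x y -> P x -> P y) -> P v.
Proof.
move=> [n w] + cP; elim: n u w => [|n IH] u /=; first by case=> _ <-.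
by case=> x ux /IH{}IH Pu; apply: IH; apply: cP ux Pu.
Qed.

Definition comp_adj H (v a b : V) : Prop := adj H a b /\ linked H v a.

Fact comp_sym H v a b : comp_adj H v a b -> comp_adj H v b a.
Proof.
case=> ab va; split; first exact: adj_sym.
exact: linked_trans va (linked_adj ab).
Qed.

Fact comp_irrefl H v a : ~ comp_adj H v a a.
Proof. by case=> aa _; apply: adj_irrefl aa. Qed.

Fact comp_vset H v a b : comp_adj H v a b -> linked H v a.
Proof. by case. Qed.

Definition comp H v : graph V :=
  Graph (@comp_sym H v) (@comp_irrefl H v) (@comp_vset H v).

Lemma comp_linked H v a b : linked H a b -> linked H v a -> linked (comp H v) a b.
Proof.
case=> n; elim: n a => [|n IH] a /=.
  by case=> _ <- va; apply: linked_refl.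
case=> w aw wb va; apply: (@linked_trans _ w); first exact: linked_adj.
by apply: IH => //; apply: linked_trans va (linked_adj aw).
Qed.

Lemma comp_sub H v : subgraph (comp H v) H.
Proof. by split=> [u /linked_vset[]|a b []]. Qed.

Lemma comp_connected H v : vset H v -> connected (comp H v).
Proof.
move=> Hv; apply: linked_connected; first by exists v; apply: linked_refl.
move=> a b /= va vb; apply: comp_linked => //.
exact: linked_trans (linked_sym va) vb.
Qed.

Lemma connected_sub_comp H C v :
  subgraph C H -> connected C -> vset C v -> subgraph C (comp H v).
Proof.
move=> sC cC Cv; have vl u : vset C u -> linked H v u.
  by move=> Cu; apply: linked_mono sC _; apply: connected_linked.
split=> [//|a b ab]; split; first exact: sC.2.
exact: vl (adj_vset ab).
Qed.

(** Maximality determines a component by any one of its vertices, so components are proved equal by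
    exhibiting a common vertex. *)
Lemma component_comp H C v : component H C -> vset C v -> C = comp H v.
Proof.
move=> [sC cC mC] Cv; apply/esym/mC.
- exact: comp_sub.
- by apply: comp_connected; apply: sC.1.
- exact: connected_sub_comp.
Qed.

Lemma subgraph_anti G H : subgraph G H -> subgraph H G -> G = H.
Proof.
move=> [sV sE] [sV' sE']; apply: graph_eq; first exact/seteqP.
by move=> u v; split; [apply: sE | apply: sE'].
Qed.

Lemma comp_component H v : vset H v -> component H (comp H v).
Proof.
move=> Hv; split; [exact: comp_sub | exact: comp_connected |].
move=> C sC cC sHC; apply: subgraph_anti => //.
by apply: connected_sub_comp => //; apply: sHC.1; apply: linked_refl.
Qed.

Lemma delete_anti G X X' : X `<=` X' -> subgraph (delete G X') (delete G X).
Proof.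
move=> XX'; split=> [u [Gu nXu]|u v [uv nXu nXv]]; first by split=> // /XX'.
by split=> // /XX'.
Qed.

Lemma linked_segment H p i j : i <= j -> vset H (p i) ->
  (forall k, i <= k -> k < j -> adj H (p k) (p k.+1)) -> linked H (p i) (p j).
Proof.
move=> + Hi; elim: j => [|j IH]; rewrite leq_eqVlt => /orP[/eqP<- _|] //;
  try exact: linked_refl.
move=> ij ad.
apply: (@linked_trans _ (p j)); last by apply: linked_adj; apply: ad.
by apply: IH => // k ik kj; apply: ad; lia.
Qed.

End Walks.

(** * Directions and rays *)

Section Directions.
Variables (V : Type) (G : graph V).
Implicit Types (X : finvset G) (f h : finvset G -> graph V) (r q : nat -> V).

Lemma finvset_finite X : finite_set X.
Proof. by case: X. Qed.

Lemma finvset_sub X : X `<=` vset G.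
Proof. by case: X. Qed.

Lemma finvsetU X X' : exists Y : finvset G, Y = X `|` X' :> set V.
Proof.
have fY : finite_set (X `|` X').
  by rewrite finite_setU; split; apply: finvset_finite.
have sY : X `|` X' `<=` vset G by rewrite subUset; split; apply: finvset_sub.
by exists (FinVSet fY sY).
Qed.

Lemma dir_comp f X v : is_direction f -> vset (f X) v -> f X = comp (delete G X) v.
Proof. by case=> dc _ fv; apply: component_comp (dc X) fv. Qed.

Lemma dir_nonempty f X : is_direction f -> exists v, vset (f X) v.
Proof. by case=> dc _; case: (dc X) => _ []. Qed.

Lemma dir_anti f X X' v : is_direction f -> X `<=` X' -> vset (f X') v -> vset (f X) v.
Proof. by case=> _ m /m[sV _] /sV. Qed.

Lemma dir_vset f X v : is_direction f -> vset (f X) v -> vset G v /\ ~ fset_of X v.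
Proof. by case=> dc _ fv; case: (dc X) => -[sV _] _ _; apply: sV. Qed.

Lemma dir_linked f X u v : is_direction f -> vset (f X) u ->
  vset (f X) v <-> linked (delete G X) u v.
Proof. by move=> df fu; rewrite (dir_comp df fu). Qed.

Lemma dir_eq f h X v : is_direction f -> is_direction h ->
  vset (f X) v -> vset (h X) v -> f X = h X.
Proof. by move=> df dh fv hv; rewrite (dir_comp df fv) (dir_comp dh hv). Qed.

(* [f] is the direction of the end containing [r]. *)
Definition ray_dir r f : Prop :=
  forall X, exists N, forall n, N <= n -> vset (f X) (r n).

Lemma ray_escapes r X : is_ray G r -> exists N, forall n, N <= n -> ~ fset_of X (r n).
Proof.
case=> ri _; have /finite_nat_bound[N HN] : finite_set (r @^-1` fset_of X).
  by apply: finite_preimage (finvset_finite X) => i j _ _; apply: ri.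
by exists N => n Nn Xn; have := HN n Xn; lia.
Qed.

End Directions.

Section RayDirections.
Variables (V : Type) (G : graph V).
Implicit Types (X : finvset G) (f h : finvset G -> graph V) (r q : nat -> V).

Lemma ray_vset H r i : @is_ray V H r -> vset H (r i).
Proof. by case=> _ ad; apply: adj_vset (ad i). Qed.

Lemma ray_mono H r : subgraph H G -> is_ray H r -> is_ray G r.
Proof. by move=> [_ sE] [ri re]; split=> // i; apply: sE. Qed.

(** The direction sends [X] to the component of [G - X] that holds a tail of [r] avoiding [X]. *)
Lemma ray_dir_exists r : is_ray G r -> exists f, is_direction f /\ ray_dir r f.
Proof.
move=> rr; have [N avoid] := choice (fun X => ray_escapes X rr).
have del X n : N X <= n -> vset (delete G X) (r n).
  by move=> Nn; split; [apply: ray_vset rr | apply: avoid].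
have tail X n : N X <= n -> linked (delete G X) (r (N X)) (r n).
  move=> Nn; apply: linked_segment => //; first exact: del.
  by move=> k Nk _; split; [apply: rr.2 | apply: avoid | apply: avoid; lia].
exists (fun X => comp (delete G X) (r (N X))); split; last first.
  by move=> X; exists (N X) => n; apply: tail.
split=> [X|X X' XX']; first by apply: comp_component; apply: del.
(* Both indices start tails avoiding [X], and these tails overlap. *)
have <- : comp (delete G X) (r (N X')) = comp (delete G X) (r (N X)).
  have [vl sl] : linked (delete G X) (r (N X)) (r (N X + N X')) /\
      linked (delete G X) (r (N X')) (r (N X + N X')).
    split; first by apply: tail; lia.
    by apply: linked_mono (delete_anti _ XX') _; apply: tail; lia.
  have eqX : linked (delete G X) (r (N X)) (r (N X')).
    exact: linked_trans vl (linked_sym sl).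
  apply: esym; apply: component_comp => //.
  by apply: comp_component; apply: del.
apply: connected_sub_comp.
- have [a1 a2] := comp_sub (delete G X') (r (N X')).
  have [b1 b2] := delete_anti G XX'.
  by split=> [u /a1/b1//|u v /a2/b2].
- by apply: comp_connected; apply: del.
- by apply: linked_refl; apply: del.
Qed.

Lemma ray_dir_equiv f r q : is_direction f -> ray_dir r f -> ray_dir q f ->
  ray_equiv G r q.
Proof.
move=> df rf qf X sep; have [N fN] := rf X; have [M fM] := qf X.
have /(dir_linked (q M) df) lrq := fN N (leqnn N).
have /lrq{lrq} lrq := fM M (leqnn M).
have [||p [n pp]] := linked_AB_path (A := range r) (B := range q) lrq.
- by exists N.
- by exists M.
have [pv pi pe] := pp; have [|i i_n Xi] := sep p n.
  have [v1 v2 v3] := pv; split=> //; split=> //.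
  - by move=> i /v1[].
  - by move=> i /v3[].
by have [/(_ i i_n)[]] := pv.
Qed.

(** Otherwise [f X'] would be closed under adjacency in [G - X], hence would contain all of [f X],
    even the deleted vertex [v]. *)
Lemma dir_step f X X' v : is_direction f -> vset (f X) v ->
  X' = X `|` [set v] :> set V -> exists w, adj G v w /\ vset (f X') w.
Proof.
move=> df fv eX; have XX' : X `<=` X' by rewrite eX => x; left.
have [z fz] := dir_nonempty X' df; apply: contrapT => none.
suff : vset (f X') v by case/(dir_vset df) => _; rewrite eX; apply; right.
have lzv : linked (delete G X) z v by apply/(dir_linked _ df)=> //; apply: dir_anti fz.
apply: (linked_closed lzv fz) => x y [xy Xx Xy] fx.
apply/(dir_linked _ df fx)/linked_adj; split=> //; first by case: (dir_vset df fx).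
rewrite eX => -[//|yv]; apply: none; exists x; split=> //.
by rewrite -yv; apply: adj_sym.
Qed.

(** Deleting each visited vertex before moving on makes the ray injective. It stays in [f X], but
    its own direction need not be [f]. *)
Lemma dir_ray f X : is_direction f -> exists r, is_ray G r /\ forall i, vset (f X) (r i).
Proof.
move=> df; have [v0 fv0] := dir_nonempty X df.
(* The step is made total for [choice]: a pair whose vertex lies outside its component is left
   unchanged. *)
have : forall s : finvset G * V, exists s' : finvset G * V, vset (f s.1) s.2 ->
    [/\ s'.1 = s.1 `|` [set s.2] :> set V, adj G s.2 s'.2 & vset (f s'.1) s'.2].
  move=> [Y v] /=; have [fv|nfv] := pselect (vset (f Y) v); last by exists (Y, v).
  have [Gv _] := dir_vset df fv.
  have sv : [set v] `<=` vset G by move=> _ ->.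
  have [Y' eY'] := finvsetU Y (FinVSet (finite_set1 v) sv).
  by have [w [vw fw]] := dir_step df fv eY'; exists (Y', w).
case/choice => next nextP; pose s n := iter n next (X, v0).
have fs n : vset (f (s n).1) (s n).2 by elim: n => //= n /nextP[].
have sub i j : i <= j -> (s i).1 `<=` (s j).1.
  move=> /subnKC<-; elim: (j - i) => [|k IH]; first by rewrite addn0.
  rewrite addnS /= => x /IH; have [-> _ _] := nextP _ (fs (i + k)); by left.
exists (fun n => (s n).2); split; last by move=> i; apply: dir_anti (sub 0 i _) (fs i).
split=> [|i]; last by have [] := nextP _ (fs i).
apply: increasing_inj => i j ij e.
have [_] := dir_vset df (fs j); apply; apply: sub ij _ _.
by have [-> _ _] := nextP _ (fs i); right.
Qed.

End RayDirections.

(** * The order of a rooted tree *)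

Lemma path_prefix (V : Type) (H : graph V) p n k :
  is_path H p n -> k <= n -> is_path H p k.
Proof.
by move=> [v i e] kn; split=> *; [apply: v|apply: i|apply: e] => //; lia.
Qed.

Lemma path_shift (V : Type) (H : graph V) p n k :
  is_path H p n -> k <= n -> is_path H (fun i => p (k + i)) (n - k).
Proof.
move=> [v i e] kn; split=> [a la|a b la lb pab|a la].
- by apply: v; lia.
- by have := i _ _ _ _ pab; lia.
- by rewrite addnS; apply: e; lia.
Qed.

Lemma path_rcons (V : Type) (H : graph V) p n v :
  is_path H p n -> adj H (p n) v -> (forall i, i <= n -> p i <> v) ->
  is_path H (fun i => if i <= n then p i else v) n.+1.
Proof.
move=> [pv pi pe] nv pNv; split=> [i _|i j|i].
- by case: ifP => [/pv//|_]; apply: adj_vsetr nv.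
- case: (leqP i n) => i_n; case: (leqP j n) => j_n i_n1 j_n1 e.
  + exact: pi.
  + by case: (pNv i).
  + by case: (pNv j).
  + lia.
- rewrite ltnS => i_n; rewrite i_n; case: (ltnP i n) => [|ni]; first exact: pe.
  by have -> : i = n by lia.
Qed.

Section Trees.
Variables (V : Type) (T : graph V) (r : V).
Hypothesis hT : is_rooted_tree T r.
Implicit Types (u v w : V) (p q : nat -> V).

Let tree_connected : connected T. Proof. by case: hT => -[]. Qed.
Let tree_acyclic : acyclic T. Proof. by case: hT => -[]. Qed.
Let tree_root : vset T r. Proof. by case: hT. Qed.

(** Before their last step both paths avoid the common end [v], so [p n] and [q m] are joined in
    [T - v]; a nontrivial path between them there would close up through [v] to a cycle. *)
Lemma tree_bypass p n m q : is_path T p n.+1 -> is_path T q m.+1 ->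
  p 0 = q 0 -> p n.+1 = q m.+1 -> p n = q m.
Proof.
move=> pp qq e0 en; set v := p n.+1.
have avoid s k : is_path T s k.+1 -> s k.+1 = v ->
    linked (delete T [set v]) (s 0) (s k).
  move=> [sv si se] sk.
  have Nv i : i <= k -> s i <> v by rewrite -sk => ik /si; lia.
  apply: linked_segment => //; first by split; [apply: sv | apply: Nv].
  by move=> i _ ik; split; [apply: se; lia | apply: Nv; lia | apply: Nv; lia].
have lpq : linked (delete T [set v]) (p n) (q m).
  apply: linked_trans (linked_sym (avoid p n pp erefl)) _.
  by rewrite e0; apply: avoid.
have [s [k [[sv si se] s0 sk]]] := linked_path lpq.
have ss : is_path T s k by split=> // i /[dup] ik; [move/sv => -[] | move/se => -[]].
have adjv : adj T (s k) v by rewrite sk /v en; case: qq => _ _; apply.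
have sNv i : i <= k -> s i <> v by move=> /sv[].
have {ss adjv} pr := path_rcons ss adjv sNv.
case: k sk s0 sv pr {si se sNv} => [|k] sk s0 sv pr; first by rewrite -s0 -sk.
exfalso; apply: (tree_acyclic (n := k.+2)); split; [by [] | exact: pr |].
cbv beta; rewrite ltnn leq0n s0; apply: adj_sym.
by case: pp => _ _; apply.
Qed.

Lemma tree_path_unique p q n m : is_path T p n -> is_path T q m ->
  p 0 = q 0 -> p n = q m -> n = m /\ forall i, i <= n -> p i = q i.
Proof.
elim: n m => [|n IH] [|m] pp qq e0 en.
- by split=> // -[].
- by have [_ /(_ 0 m.+1)qi _] := qq; rewrite -e0 in qi; have := qi isT (leqnn _) en.
- by have [_ /(_ n.+1 0)pi _] := pp; rewrite -e0 in en; have := pi (leqnn _) isT en.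
have e := tree_bypass pp qq e0 en.
have [enm epq] := IH m (path_prefix pp (leqnSn n)) (path_prefix qq (leqnSn m)) e0 e.
subst m; split=> // i; rewrite leq_eqVlt => /orP[/eqP->//|]; exact: epq.
Qed.

Lemma tree_root_path v : vset T v -> exists p n, [/\ is_path T p n, p 0 = r & p n = v].
Proof. by move=> Tv; case: tree_connected => _; apply. Qed.

Lemma tree_le_vset u v : tree_le T r u v -> vset T u /\ vset T v.
Proof.
by case=> p [n [[pv _ _] _ <- [i i_n <-]]]; split; apply: pv.
Qed.

Lemma tree_le_path p n i : is_path T p n -> p 0 = r -> i <= n -> tree_le T r (p i) (p n).
Proof. by move=> pp p0 i_n; exists p, n; split=> //; exists i. Qed.

Lemma tree_le_on_path p n u : is_path T p n -> p 0 = r -> tree_le T r u (p n) ->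
  exists2 i, i <= n & p i = u.
Proof.
move=> pp p0 [q [m [qq q0 qm [i im qi]]]].
have [e eq] := tree_path_unique qq pp (etrans q0 (esym p0)) qm.
by exists i; rewrite -?e // -eq.
Qed.

Lemma tree_le_refl v : vset T v -> tree_le T r v v.
Proof.
by case/tree_root_path => p [n [pp p0 <-]]; apply: tree_le_path.
Qed.

Lemma tree_le_root v : vset T v -> tree_le T r r v.
Proof.
case/tree_root_path => p [n [pp p0 <-]].
by have := tree_le_path pp p0 (leq0n n); rewrite p0.
Qed.

Lemma tree_le_trans v u w : tree_le T r u v -> tree_le T r v w -> tree_le T r u w.
Proof.
move=> + [p [n [pp p0 <- [i i_n pi]]]]; rewrite -pi => uv.
have [j ji <-] := tree_le_on_path (path_prefix pp i_n) p0 uv.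
by apply: tree_le_path => //; lia.
Qed.

Lemma tree_le_anti u v : tree_le T r u v -> tree_le T r v u -> u = v.
Proof.
move=> [p [n [pp p0 <- [i i_n <-]]]] ni.
have [j ji pj] := tree_le_on_path (path_prefix pp i_n) p0 ni.
have [_ inj _] := pp; have jn : j = n by apply: inj => //; lia.
by congr p; lia.
Qed.

Lemma tree_le_total u v w : tree_le T r u w -> tree_le T r v w ->
  tree_le T r u v \/ tree_le T r v u.
Proof.
move=> [p [n [pp p0 <- [i i_n <-]]]] /(tree_le_on_path pp p0)[j jn <-].
case: (leqP i j) => [ij|/ltnW ji]; [left|right].
  exact: tree_le_path (path_prefix pp jn) p0 ij.
exact: tree_le_path (path_prefix pp i_n) p0 ji.
Qed.

Lemma tree_adj_comparable u v : adj T u v -> tree_le T r u v \/ tree_le T r v u.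
Proof.
move=> uv; have [p [n [pp p0 pn]]] := tree_root_path (adj_vset uv).
have [[i i_n pi]|nv] := pselect (exists2 i, i <= n & p i = v).
  by right; rewrite -pn -pi; apply: tree_le_path.
left; rewrite -pn in uv.
have nv' i : i <= n -> p i <> v by move=> i_n e; apply: nv; exists i.
have := tree_le_path (path_rcons pp uv nv') _ (leqnSn n).
by rewrite leqnn ltnn pn leq0n; apply.
Qed.

Lemma tree_down_finite v : finite_set [set u | tree_le T r u v].
Proof.
(* A vertex outside [T] has an empty down-set. *)
have [[p [n [pp p0 pn _]]]|none] := pselect (tree_le T r v v); last first.
  apply: (sub_finite_set _ (finite_set0 V)) => u /tree_le_vset[_ /tree_le_refl].
  exact: none.
apply: (@sub_finite_set _ _ (p @` `I_n.+1)); last exact: finite_image (finite_II _).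
move=> u; rewrite -{1}pn => /(tree_le_on_path pp p0)[i i_n pi].
by exists i => //=; rewrite ltnS.
Qed.

Lemma tree_up_linked G X u v : subgraph T G -> tree_le T r u v ->
  (forall x, tree_le T r u x -> ~ X x) -> linked (delete G X) u v.
Proof.
move=> [sV sE] [p [n [pp p0 <- [i i_n <-]]]] nX.
have Xp k : i <= k -> k <= n -> ~ X (p k).
  by move=> ik kn; apply: nX; apply: tree_le_path (path_prefix pp kn) p0 ik.
have [pv _ pe] := pp; apply: linked_segment => //.
  by split; [apply/sV/pv | apply: Xp].
by move=> k ik kn; split; [apply/sE/pe | apply: Xp; lia | apply: Xp; lia].
Qed.

End Trees.

(** * Normal trees *)

Section NormalTrees.
Variables (V : Type) (G T : graph V) (r : V).
Hypothesis hT : is_normal_tree G T r.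
Implicit Types (f h : finvset G -> graph V).

Let rooted : is_rooted_tree T r. Proof. by case: hT. Qed.
Let sub : subgraph T G. Proof. by case: hT. Qed.

(** A path in [G - X] is followed from one visit of [T] to the next. Consecutive visits are
    comparable, by normality or as ends of an edge of [T], and induction on the length carries a
    common lower bound back to [v]. *)
Lemma normal_separation X v w : vset T v -> vset T w -> linked (delete G X) v w ->
  exists m, [/\ tree_le T r m v, tree_le T r m w & ~ X m].
Proof.
move=> + Tw vw; have [p [n []]] := linked_path vw; move: vw => _.
elim/ltn_ind: n p v => n IH p v pp <- pn {v} Tv.
have [pv pi pe] := pp.
have [n0|n0] := posnP n.
  have T0 := tree_le_refl rooted Tv; exists (p 0).
  rewrite -pn n0; split=> //; by have [] := pv 0.
have [|k [[k0 kn Tk] kmin]] := @least_nat (fun k => [/\ 0 < k, k <= n & vset T (p k)]).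
  by exists n; rewrite n0 leqnn pn.
have cmp : tree_le T r (p 0) (p k) \/ tree_le T r (p k) (p 0).
  have [[k1 T01]|nT01] := pselect (k = 1 /\ adj T (p 0) (p 1)).
    by rewrite k1; apply: tree_adj_comparable.
  case: hT => _ _; apply; split=> //.
  - have [qv qi qe] := path_prefix pp kn.
    by split=> // i; [move=> /qv[] | move=> /qe[]].
  - move=> i ik; split=> [Ti|[->|->]//].
    case: (posnP i) => [|i0]; [by left|right].
    by have := kmin i (And3 i0 (leq_trans ik kn) Ti); lia.
  - move=> i ik Ti; apply: nT01.
    have i0 : i = 0.
      case: (posnP i) => // i0.
      by have := kmin i (And3 i0 (leq_trans (ltnW ik) kn) (adj_vset Ti)); lia.
    rewrite i0 in Ti ik *; split=> //.
    have := kmin 1 (And3 isT (leq_trans k0 kn) (adj_vsetr Ti)); lia.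
have [m [mk mw nXm]] : exists m, [/\ tree_le T r m (p k), tree_le T r m w & ~ X m].
  apply: (IH (n - k) _ (fun i => p (k + i))) => //; first lia.
  - exact: path_shift.
  - by rewrite addn0.
  - by rewrite subnKC.
have nX0 : ~ X (p 0) by have [] := pv 0.
have T0 := tree_le_refl rooted Tv.
case: cmp => [p0k|pk0]; last first.
  by exists m; split=> //; apply: (tree_le_trans rooted) mk pk0.
(* Both [m] and [p 0] lie below [p k]; if [m] is not below [p 0], then [p 0] is below [m] and itself
   serves. *)
have [m0|p0m] := tree_le_total rooted mk p0k; first by exists m.
by exists (p 0); split=> //; apply: (tree_le_trans rooted) p0m mw.
Qed.

Lemma finvset_down : exists dn : V -> finvset G,
  forall t, dn t = [set u | tree_le T r u t] :> set V.
Proof.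
suff /choice[dn dnE] : forall t, exists X : finvset G,
    X = [set u | tree_le T r u t] :> set V by exists dn.
move=> t; have sG : [set u | tree_le T r u t] `<=` vset G.
  by move=> u ut; case: (tree_le_vset ut) => /sub.1.
by exists (FinVSet (tree_down_finite rooted t) sG).
Qed.

(* A ray living in a component of [G - X] that avoids [T] is separated by [X]
   from every ray of [T]. *)
Lemma dir_meets_tree f X :
  (forall w, is_end G w -> exists2 q, w q & is_ray T q) ->
  is_direction f -> exists2 v, vset T v & vset (f X) v.
Proof.
move=> ends df; apply: contrapT => none.
have [R [rR fR]] := dir_ray X df.
have [|q [rq eqv] Tq] := ends [set q | is_ray G q /\ ray_equiv G R q]; first by exists R.
apply: (eqv X) => p n [[pv pi pe] pA pB]; apply: contrapT => nX.
have Xp i : i <= n -> ~ fset_of X (p i) by move=> i_n Xi; apply: nX; exists i.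
have [i _ Ri] : range R (p 0) by apply/pA.
have [j _ qj] : range q (p n) by apply/pB.
apply: none; exists (p n); first by rewrite -qj; apply: ray_vset.
apply/(dir_linked (p n) df (u := p 0)); first by rewrite -Ri.
apply: linked_segment => //; first by split; [apply: pv | apply: Xp].
by move=> k _ kn; split; [apply: pe | apply: Xp; lia | apply: Xp].
Qed.

Lemma tree_countably_determined :
  countable (vset T) ->
  (forall w, is_end G w -> exists2 q, w q & is_ray T q) ->
  countably_determined G.
Proof.
move=> cT ends.
have [dn dnE] := finvset_down.
(* Components are indexed by their vertices in [T], so pairs of tree vertices encode the choices. *)
pose c (p : V * V) := (dn p.1, comp (delete G (dn p.1)) p.2).
exists (c @` [set p | (vset T `*` vset T) p /\ ~ fset_of (dn p.1) p.2]); split.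
- apply: sub_countable (card_image_le _ _) _.
  apply: sub_countable (countableX cT cT).
  by apply: subset_card_le => p [].
- move=> _ [[t v] [[/= Tt Tv] nv] <-]; apply: comp_component => /=.
  by split=> //; apply: sub.1.
move=> f h df dh fh; have [X fhX] : exists X, f X <> h X.
  by apply: contrapT => none; apply: fh; apply/funext => X; apply: contrapT => e;
    apply: none; exists X.
have [Y YE] : exists Y : finvset G, forall y,
    fset_of Y y <-> y = r \/ exists x, [/\ fset_of X x & tree_le T r y x].
  have fY : finite_set (r |` \bigcup_(x in X) [set y | tree_le T r y x]).
    rewrite finite_setU; split; first exact: finite_set1.
    apply: bigcup_finite; first exact: finvset_finite.
    by move=> x _; apply: tree_down_finite.
  have sY : r |` \bigcup_(x in X) [set y | tree_le T r y x] `<=` vset G.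
    move=> y [->|[x _ yx]]; apply: sub.1; first by case: rooted.
    by case: (tree_le_vset yx).
  exists (FinVSet fY sY) => y; split=> [[yr|[x Xx yx]]|[yr|[x [Xx yx]]]].
  - by left.
  - by right; exists x.
  - by left.
  - by right; exists x.
have Ydown y y' : tree_le T r y y' -> fset_of Y y' -> fset_of Y y.
  move=> yy' /YE[y'r|[x [Xx y'x]]]; apply/YE; last first.
    by right; exists x; split=> //; apply: (tree_le_trans rooted) yy' y'x.
  left; rewrite y'r in yy'; apply: (tree_le_anti rooted) => //.
  by apply: (tree_le_root rooted); case: (tree_le_vset yy').
have [Z ZE] := finvsetU X Y.
have [v Tv fv] := dir_meets_tree Z ends df.
have [w Tw hw] := dir_meets_tree Z ends dh.
have XZ : X `<=` Z by rewrite ZE => x; left.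
have [p [n [pp p0 pn]]] := tree_root_path rooted Tv.
(* [k] counts back from [v], so the least [k] gives the last vertex of [Y] on the root path; the
   root, being in [Y], ensures that there is one. *)
have [|k [[kn Yk] kmin]] := @least_nat (fun k => k <= n /\ fset_of Y (p (n - k))).
  by exists n; rewrite subnn p0; split=> //; apply/YE; left.
set s := p (n - k) in Yk.
have sv : tree_le T r s v by rewrite -pn; apply: tree_le_path => //; lia.
have Ts : vset T s by case: (tree_le_vset sv).
have sZ : dn s `<=` Z.
  by rewrite dnE ZE => u us; right; apply: Ydown Yk.
have fsv := dir_anti df sZ fv; have hsw := dir_anti dh sZ hw.
exists (c (s, v)).
  by exists (s, v) => //; split=> //=; case: (dir_vset df fsv).
split; rewrite /= -(dir_comp df fsv) // => ehf; apply: fhX.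
have [m [mv mw nm]] : exists m,
    [/\ tree_le T r m v, tree_le T r m w & ~ fset_of (dn s) m].
  apply: normal_separation => //; apply/(dir_linked _ df fsv); by rewrite -ehf.
(* [m] lies beyond [s] on the root path to [v]; if it were below a vertex of [X], it would be in
   [Y], against the choice of [s]. *)
have nX x : tree_le T r m x -> ~ fset_of X x.
  move=> mx Xx; rewrite -pn in mv.
  have Ym : fset_of Y m by apply/YE; right; exists x.
  have [j jn pj] := tree_le_on_path rooted pp p0 mv.
  have jk : n - k < j.
    rewrite ltnNge; apply/negP => jk; apply: nm; rewrite dnE -pj /=.
    by apply: tree_le_path jk => //; apply: path_prefix pp _; lia.
  have := kmin (n - j); rewrite subKn // pj => /(_ (conj (leq_subr _ _) Ym)); lia.
have mvX := tree_up_linked sub mv nX; have mwX := tree_up_linked sub mw nX.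
apply: (@dir_eq _ _ _ _ _ w) => //; last by apply: dir_anti hw.
apply/(dir_linked _ df (dir_anti df XZ fv)).
exact: linked_trans (linked_sym mvX) mwX.
Qed.

(** A vertex [t] below every vertex of [T] in [f (dn t)] has a successor with the same property;
    iteration from the root gives the ray. Only sets inside [T] are controlled at this stage. *)
Lemma tree_ray f : is_direction f ->
  (forall X : finvset G, X `<=` vset T -> exists2 v, vset T v & vset (f X) v) ->
  exists q, is_ray T q /\ forall X : finvset G, X `<=` vset T ->
    exists N, forall n, N <= n -> vset (f X) (q n).
Proof.
move=> df meets; have [dn dnE] := finvset_down.
have dnT t : dn t `<=` vset T by rewrite dnE => u ut; case: (tree_le_vset ut).
pose P t := vset T t /\ forall x, vset T x -> vset (f (dn t)) x -> tree_le T r t x.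
have : forall t, exists t', P t -> [/\ P t', adj T t t' & tree_le T r t t'].
  move=> t; have [[Tt Pt]|nP] := pselect (P t); last by exists t.
  have [v Tv fv] := meets (dn t) (dnT t).
  have [p [n [pp p0 pn]]] := tree_root_path rooted Tv.
  have [] := @tree_le_on_path _ _ _ rooted p n t pp p0; first by rewrite pn; apply: Pt.
  move=> i i_n pi; have {}i_n : i < n.
    rewrite ltn_neqAle i_n andbT; apply/eqP => i_n'.
    have [_] := dir_vset df fv; apply; rewrite dnE -pn -i_n' pi.
    exact: (tree_le_refl rooted).
  have tp : tree_le T r t (p i.+1).
    by rewrite -pi; apply: tree_le_path (path_prefix pp i_n) p0 (leqnSn i).
  have [pv _ pe] := pp.
  exists (p i.+1) => _; split=> //; last by rewrite -pi; apply: pe.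
  split=> [|x Tx fx]; first exact: pv.
  have fx' : vset (f (dn t)) x.
    apply: dir_anti df _ fx; rewrite !dnE => u ut.
    exact: (tree_le_trans rooted) ut tp.
  (* This lower bound of [v] and [x] lies on the root path to [v] and outside the down-set of [t],
     hence at or beyond [p i.+1]. *)
  have /(normal_separation Tv Tx)[m [mv mx nm]] : linked (delete G (dn t)) v x.
    exact/(dir_linked _ df fv).
  apply: (tree_le_trans rooted) mx; rewrite -pn in mv.
  have [j jn pj] := tree_le_on_path rooted pp p0 mv; rewrite -pj.
  apply: (tree_le_path (path_prefix pp jn) p0); rewrite ltnNge; apply/negP => ji.
  apply: nm; rewrite dnE -pj -pi.
  by apply: (tree_le_path (path_prefix pp (ltnW i_n)) p0).
case/choice => next nextP; pose q n := iter n next r.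
have Pq n : P (q n).
  elim: n => [|n IH]; last by have [] := nextP _ IH.
  by split=> [|x Tx _]; [case: rooted | apply: (tree_le_root rooted)].
have qadj n : adj T (q n) (q n.+1) by have [] := nextP _ (Pq n).
have qle i j : i <= j -> tree_le T r (q i) (q j).
  move=> /subnKC<-; elim: (j - i) => [|k IH].
    by rewrite addn0; apply: (tree_le_refl rooted); case: (Pq i).
  rewrite addnS; apply: (tree_le_trans rooted) IH _.
  by have [] := nextP _ (Pq (i + k)).
have qT : is_ray T q.
  split=> //; apply: increasing_inj => i j /qle ij e; rewrite -e in ij.
  have := qadj i; rewrite (tree_le_anti rooted ij (qle _ _ (leqnSn i))).
  exact: adj_irrefl.
exists q; split=> // X XT.
have qG := ray_mono sub qT.
(* Once [q n] has left the down-closure of [X], nothing above [q n] is in [X], so the tree joins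
   [q n] to [v] outside [X]. *)
have fY : finite_set (\bigcup_(x in X) dn x).
  apply: bigcup_finite; first exact: finvset_finite.
  by move=> x _; apply: finvset_finite.
have sY : \bigcup_(x in X) dn x `<=` vset G by move=> y [x _ /dnT/sub.1].
have [N Nq] := ray_escapes (FinVSet fY sY) qG.
exists N => n Nn; have [Z ZE] := finvsetU X (dn (q n)).
have [v Tv fv] : exists2 v, vset T v & vset (f Z) v.
  by apply: meets; rewrite ZE subUset; split=> //; apply: dnT.
have qv : tree_le T r (q n) v.
  by apply: (Pq n).2 => //; apply: dir_anti df _ fv; rewrite ZE => x; right.
have fXv : vset (f X) v by apply: dir_anti df _ fv; rewrite ZE => x; left.
apply/(dir_linked _ df fXv)/linked_sym; apply: tree_up_linked sub qv _ => x qx Xx.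
by apply: (Nq n Nn); exists x => //; rewrite dnE.
Qed.

End NormalTrees.

(** * Directions missing the vertices of the choices *)

Lemma finvset_eq (V : Type) (G : graph V) (X X' : finvset G) :
  X = X' :> set V -> X = X'.
Proof.
case: X => X fX sX; case: X' => X' fX' sX' /= e; subst X'.
by congr FinVSet; apply: Prop_irrelevance.
Qed.

(** A set of vertices in place of a ray avoids a default ray when [K] is empty. *)
Lemma countable_cover (V : Type) (K : set (nat -> V)) :
  exists W : set V, countable W /\ ((exists q, K q) -> exists2 q, K q & range q `<=` W).
Proof.
have [[q Kq]|none] := pselect (exists q, K q); last first.
  by exists set0; split; first exact: countable0.
exists (range q); split=> [|_]; last by exists q.
by apply: sub_countable (card_image_le _ _) _; apply: countableP.
Qed.

Lemma countableU (U : Type) (A B : set U) :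
  countable A -> countable B -> countable (A `|` B).
Proof.
move=> cA cB; rewrite -bigcup2E; apply: bigcup_countable => // -[|[|n]] _ //=.
Qed.

Section DeterminingChoices.
Variables (V : Type) (G : graph V) (D : set (finvset G * graph V)).
Hypothesis D_distinguishes : forall f h, is_direction f -> is_direction h ->
  f <> h -> exists2 c, D c & distinguishes c f h.
Implicit Types (f h : finvset G -> graph V) (X Y : finvset G).

(** The ray found in [T] has some direction [h]; it agrees with [f] on the sets of all choices, so
    no choice tells the two apart. *)
Lemma direction_in_tree T r f : is_normal_tree G T r ->
  (forall c, D c -> c.1 `<=` vset T) -> is_direction f ->
  (forall X, X `<=` vset T -> exists2 v, vset T v & vset (f X) v) ->
  exists2 q, is_ray T q & ray_dir q f.
Proof.
move=> nT DT df /(tree_ray nT df)[q [qT qf]]; exists q => //.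
have [_ sT _] := nT; have qG := ray_mono sT qT.
have [h [dh qh]] := ray_dir_exists qG.
suff -> : f = h by [].
apply: contrapT => /(D_distinguishes df dh)[c Dc [<-]]; apply.
have [N fN] := qf _ (DT _ Dc); have [M hM] := qh c.1.
by apply: (@dir_eq _ _ _ _ _ (q (N + M))) => //; [apply: hM | apply: fN]; lia.
Qed.

Variable S : set V.
Hypothesis D_countable : countable D.
Hypothesis S_countable : countable S.
Hypothesis DS : forall c, D c -> c.1 `<=` S.

Definition misses f X : Prop := forall v, vset (f X) v -> ~ S v.

Lemma misses_linked f X Y u v : is_direction f -> misses f X -> Y `<=` S ->
  vset (f X) u -> vset (f X) v -> linked (delete G Y) u v.
Proof.
move=> df mf YS fu /(dir_linked _ df fu) uv.
suff [] : linked (delete G Y) u v /\ vset (f X) v by [].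
have nY x : vset (f X) x -> ~ fset_of Y x by move=> /mf + /YS.
apply: (linked_closed (P := fun x => linked (delete G Y) u x /\ vset (f X) x) uv).
  by split=> //; apply: linked_refl; split; [case: (dir_vset df fu) | apply: nY].
move=> x y xy [ux fx]; have fy : vset (f X) y.
  by apply/(dir_linked _ df fx)/linked_adj.
split=> //; apply: linked_trans ux (linked_adj _).
by case: xy => xy _ _; split=> //; apply: nY.
Qed.

(** [f X] and [f Y] share the vertices of [f] at the union, and [f X] stays connected in [G - Y]
    because it avoids [S]. *)
Lemma misses_sub f X Y u : is_direction f -> misses f X -> Y `<=` S ->
  vset (f X) u -> vset (f Y) u.
Proof.
move=> df mf YS fu; have [Z ZE] := finvsetU X Y.
have [v fv] := dir_nonempty Z df.
have fXv : vset (f X) v by apply: dir_anti df _ fv; rewrite ZE => x; left.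
have fYv : vset (f Y) v by apply: dir_anti df _ fv; rewrite ZE => x; right.
exact/(dir_linked _ df fYv)/(misses_linked df mf YS).
Qed.

(** The common component at [X] lies in both [f Y] and [h Y] for every finite [Y] in [S], so no
    choice distinguishes [f] from [h]. *)
Lemma misses_inj f h X v : is_direction f -> is_direction h -> misses f X ->
  vset (f X) v -> vset (h X) v -> f = h.
Proof.
move=> df dh mf fv hv; have e := dir_eq df dh fv hv.
have mh : misses h X by move=> x; rewrite -e; apply: mf.
apply: contrapT => /(D_distinguishes df dh)[c Dc [<-]]; apply.
apply: (dir_eq dh df (v := v)); first exact: misses_sub dh mh (DS Dc) hv.
exact: misses_sub df mf (DS Dc) fv.
Qed.

(** For a direction, the neighbours of [f X] outside it lie in [X]; the second clause makes [X]
    exactly this neighbourhood. *)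
Definition tight f X : Prop :=
  misses f X /\ forall x, fset_of X x -> exists2 y, vset (f X) y & adj G x y.

(** Returning to the graph the vertices of [X] that have no neighbour in [f X] does not enlarge the
    component. *)
Lemma tight_exists f X : is_direction f -> misses f X ->
  exists2 Y : finvset G, Y `<=` X & tight f Y.
Proof.
move=> df mf; set A := [set x | fset_of X x /\ exists2 y, vset (f X) y & adj G x y].
have AX : A `<=` X by move=> x [].
have [Y YE] : exists Y : finvset G, Y = A :> set V.
  have fA : finite_set A by apply: sub_finite_set AX (finvset_finite X).
  by exists (FinVSet fA (subset_trans AX (@finvset_sub _ _ X))).
have YX : Y `<=` X by rewrite YE.
have [v fv] := dir_nonempty X df; have fYv := dir_anti df YX fv.
have fYX u : vset (f Y) u -> vset (f X) u.
  move=> /(dir_linked _ df fYv) vu; apply: (linked_closed vu fv).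
  move=> x y [xy _ nYy] fx; have [_ nXx] := dir_vset df fx.
  have nXy : ~ fset_of X y.
    by move=> Xy; apply: nYy; rewrite YE; split=> //; exists x => //; apply: adj_sym.
  exact/(dir_linked _ df fx)/linked_adj.
exists Y => //; split=> [u /fYX/mf//|x].
rewrite YE => -[_ [y fy xy]]; exists y => //; exact: dir_anti fy.
Qed.

(* If [X] is not contained in [Y], then [f Y] and [h Y] share a vertex of
   [X]; so [X] is contained in [Y], and [f Y] in [f X]. *)
Lemma tight_choice f h X Y : is_direction f -> is_direction h ->
  tight f X -> tight h X -> Y `<=` S -> f Y <> h Y ->
  forall v, vset (f Y) v -> vset (f X) v.
Proof.
move=> df dh [mf tf] [mh th] YS fhY v; apply: dir_anti => // x Xx.
apply: contrapT => nYx; apply: fhY.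
have key g : is_direction g -> misses g X ->
    (exists2 y, vset (g X) y & adj G x y) -> vset (g Y) x.
  move=> dg mg [y gy xy]; have gYy := misses_sub dg mg YS gy.
  apply/(dir_linked _ dg gYy)/linked_adj; split=> //; first exact: adj_sym.
  by case: (dir_vset dg gYy).
by apply: (dir_eq df dh (v := x)); apply: key => //; [apply: tf | apply: th].
Qed.

(* A direction tight at [X] is the only one, or is recognised among these by
   the component of a choice in [D]. *)
Lemma countable_ray_cover : exists2 W : set V, countable W &
  forall f X, is_direction f -> X `<=` S -> misses f X ->
    exists q, [/\ is_ray G q, ray_dir q f & range q `<=` W].
Proof.
(* At most one ray is kept for each finite [A] in [S] and each [B], where [B] is everything or the
   component of a choice. *)
pose K A (B : set V) q := exists X f, [/\ X = A :> set V, is_direction f, tight f X,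
  (exists2 v, vset (f X) v & B v) & is_ray G q /\ ray_dir q f].
have [W WP] := choice (fun AB => countable_cover (K AB.1 AB.2)).
have cF := countable_finite_subset S_countable.
exists (\bigcup_(A in [set A | A `<=` S /\ finite_set A])
          (W (A, setT) `|` \bigcup_(c in D) W (A, vset c.2))).
  apply: bigcup_countable => // A _; apply: countableU; first exact: (WP _).1.
  by apply: bigcup_countable => // c _; apply: (WP _).1.
move=> f X0 df X0S /(tight_exists df)[X XX0 tf].
have FX : [set A | A `<=` S /\ finite_set A] (fset_of X).
  by split; [apply: subset_trans XX0 X0S | apply: finvset_finite].
have KW (B : set V) : (exists2 v, vset (f X) v & B v) ->
    exists2 q, K X B q & range q `<=` W (fset_of X, B).
  move=> fB; apply: (WP (fset_of X, B)).2.
  have [q [qG fq]] := dir_ray X df.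
  have [h [dh qh]] := ray_dir_exists qG.
  (* The direction of a ray inside [f X] shares a vertex with [f] at [X], so it is [f] itself. *)
  have [N hN] := qh X; have fh : f = h.
    by apply: (misses_inj df dh tf.1 (fq N)); apply: hN.
  by exists q; exists X, f; split=> //; rewrite fh.
have [v fv] := dir_nonempty X df.
have [|q [X1 [h [/finvset_eq eX dh th _ [qG qh]]]] qW] := KW setT; first by exists v.
rewrite {}eX in th.
have [fh|/(D_distinguishes df dh)[c Dc [fc hc]]] := pselect (f = h).
  exists q; rewrite fh; split=> //; apply: subset_trans qW _ => x Wx.
  by exists (fset_of X) => //; left.
have fXc u : vset (f X) u -> vset (f c.1) u.
  by apply: misses_sub => //; [apply: tf.1 | apply: DS].
have {qW}[|q' [X2 [h' [/finvset_eq eX' dh' th' [u h'u cu] [qG' qh']]]] qW] :=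
  KW (vset c.2).
  by exists v => //; rewrite -fc; apply: fXc.
rewrite {}eX' in th' h'u.
(* [c.2] equals [f c.1] and lies in [f X], so the direction [h'] of the ray kept for it meets [f] at
   [X]. *)
have fu : vset (f X) u.
  apply: (tight_choice df dh tf th (DS Dc)); last by rewrite fc.
  by rewrite fc => e; apply: hc.
exists q'; rewrite (misses_inj df dh' tf.1 fu h'u); split=> //.
apply: subset_trans qW _ => x Wx; exists (fset_of X) => //; right.
by exists c.
Qed.

End DeterminingChoices.

(** * Depth-first normal trees *)

(** A walk meeting [y] has a final part starting at [y]. For the tail of a shortest walk from [y]
    this case is impossible. *)
Lemma walk_avoid (V : Type) (G : graph V) A n u y z : walk (delete G A) n u z ->
  walk (delete G (A `|` [set y])) n u z \/ exists2 m, m <= n & walk (delete G A) m y z.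
Proof.
elim: n u => [|n IH] u /= w.
  have [uy|uy] := pselect (u = y); first by right; exists 0; rewrite -?uy.
  by left; case: w => -[Gu nA] uz; split=> //; split=> // -[].
have [uy|uy] := pselect (u = y); first by right; exists n.+1; rewrite -?uy.
case: w => x [ux nAu nAx] /[dup] wx /IH[{}wx'|[m mn wy]]; last first.
  by right; exists m => //; apply: leq_trans mn _.
left; exists x => //; split=> //; first by case.
by case: (walk_vset wx') => -[].
Qed.

Section DepthFirstTree.
Variables (V : Type) (G : graph V) (e : nat -> V) (r : V).
Hypothesis G_connected : connected G.
Hypothesis e_vset : forall i, vset G (e i).
Hypothesis r_vset : vset G r.
Implicit Types (A : set V) (t u v w x y z : V).

Let conn A := linked (delete G A).

Definition first_target A v i :=
  conn A v (e i) /\ forall i', conn A v (e i') -> i <= i'.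

Definition reach A t z n y := adj G t y /\ walk (delete G A) n y z.

(** The neighbours of [t] nearest in [G - A] to the enumerated vertex of least index in the
    component of [v]. *)
Definition candidate A t v y := exists i n,
  [/\ first_target A v i, reach A t (e i) n y
    & forall n' y', reach A t (e i) n' y' -> n <= n'].

(** [xget] makes the child a function of the candidate set alone. The default [r] is taken when
    there is no candidate, as after [v] has been passed. *)
Definition child A t v : V := xget (r : {classic V}) (candidate A t v).

(* The branch towards [v]: after [n] steps, the set of the vertices passed
   and the current vertex. The next vertex depends only on these and on the
   component of [v]. *)
Definition branch v n : set V * V :=
  iter n (fun s => let A := s.1 `|` [set s.2] in (A, child A s.2 v)) (set0, r).

Local Notation past v n := (branch v n).1.
Local Notation cur v n := (branch v n).2.

Definition good v n := forall i, i <= n -> conn (past v i) (cur v i) v.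

Lemma pastS v n : past v n.+1 = past v n `|` [set cur v n].
Proof. by []. Qed.

Lemma past_cur v n x : past v n x <-> exists2 i, i < n & cur v i = x.
Proof.
elim: n => [|n IH]; first by split=> // -[].
rewrite pastS; split=> [[/IH[i i_n xi]|->]|[i]].
- by exists i => //; apply: ltnW.
- by exists n.
rewrite ltnS leq_eqVlt => /orP[/eqP-> <-|i_n xi]; first by right.
by left; apply/IH; exists i.
Qed.

Lemma past_mono v m n : m <= n -> past v m `<=` past v n.
Proof.
by move=> mn x /past_cur[i im xi]; apply/past_cur; exists i => //; apply: leq_trans mn.
Qed.

Lemma conn_past v m n x y : m <= n -> conn (past v n) x y -> conn (past v m) x y.
Proof. by move=> /past_mono/delete_anti s; apply: linked_mono. Qed.

Lemma candidate_ext A t v w : conn A v w -> candidate A t v = candidate A t w.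
Proof.
move=> vw; have eqc i : conn A v i <-> conn A w i.
  by split; apply: linked_trans => //; apply: linked_sym.
apply/funext => y; apply/propext.
split=> -[i [n [[f1 f2] rc mn]]]; exists i, n; split=> //; split.
- exact/eqc.
- by move=> i' /eqc/f2.
- exact/eqc.
- by move=> i' /eqc/f2.
Qed.

(** [v] and [w] also share a component at all earlier stages, so they have the same candidates
    there. *)
Lemma branch_agree v w n : conn (past v n) v w ->
  forall i, i <= n -> branch w i = branch v i.
Proof.
elim: n => [|n IH] vw i; first by rewrite leqn0 => /eqP->.
have {}IH := IH (conn_past (leqnSn n) vw).
rewrite leq_eqVlt => /orP[/eqP->|]; last exact: IH.
rewrite /branch !iterS -!/(branch _ _) IH //; congr pair.
by rewrite /child (candidate_ext _ vw).
Qed.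

Lemma cur_notin_past v n : good v n -> ~ past v n (cur v n).
Proof. by move=> gv; have [[]] := linked_vset (gv n (leqnn n)). Qed.

Lemma good_le v m n : m <= n -> good v n -> good v m.
Proof. by move=> mn gv i im; apply: gv; apply: leq_trans mn. Qed.

Lemma cur_branch v n : good v n -> forall i, i <= n -> branch (cur v n) i = branch v i.
Proof. by move=> gv; apply: branch_agree; apply/linked_sym/gv. Qed.

Lemma good_cur v n : good v n -> good (cur v n) n.
Proof.
move=> gv i i_n; rewrite (cur_branch gv) //.
apply: linked_trans (gv _ i_n) _.
by apply: conn_past i_n _; apply/linked_sym/gv.
Qed.

Lemma conn_step v n : conn (past v n) (cur v n) v -> cur v n <> v ->
  conn (past v n.+1) v v.
Proof.
move=> cv nev; have [_ [Gv nv]] := linked_vset cv; apply: linked_refl; split=> //.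
by rewrite pastS => -[//|/esym].
Qed.

Lemma first_target_exists v j n : v = e j -> conn (past v n.+1) v v ->
  exists i, first_target (past v n.+1) v i.
Proof. by move=> vj vv; apply: least_nat; exists j; rewrite -vj. Qed.

Lemma first_target_unique A v i i' : first_target A v i -> first_target A v i' -> i = i'.
Proof. by move=> [c1 m1] [c2 m2]; apply/eqP; rewrite eqn_leq m1 // m2. Qed.

(** A shortest walk from the current vertex to the target never returns to its start, so its second
    vertex still reaches the target once the current vertex is deleted. *)
Lemma candidate_step v j n : v = e j -> good v n -> cur v n <> v ->
  candidate (past v n.+1) (cur v n) v (cur v n.+1).
Proof.
move=> vj gv nev; have gn := gv n (leqnn n).
have [i fi] := first_target_exists vj (conn_step gn nev); have [vz _] := fi.
have tz : conn (past v n) (cur v n) (e i).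
  exact: linked_trans gn (conn_past (leqnSn n) vz).
have [m [wm mmin]] := least_nat tz.
have [_ [_ nz]] := linked_vset vz.
case: m wm mmin => [[_ ez]|m [w tw wz] mmin].
  by case: nz; rewrite -ez pastS; right.
have [wz'|[k km kz]] := walk_avoid (cur v n) wz; last by have := mmin _ kz; lia.
have [|k [[y ry] kmin]] := @least_nat
    (fun k => exists y, reach (past v n.+1) (cur v n) (e i) k y).
  by exists m, w; split=> //; case: tw.
apply: (xgetPex (r : {classic V})); exists y, i, k; split=> // k' y' r'.
by apply: kmin; exists y'.
Qed.

Lemma good_step v j n : v = e j -> good v n -> cur v n <> v -> good v n.+1.
Proof.
move=> vj gv nev i; rewrite leq_eqVlt => /orP[/eqP->|]; last exact: gv.
have [i' [k [[vz _] [_ w] _]]] := candidate_step vj gv nev.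
by apply: linked_trans (linked_sym vz); exists k.
Qed.

Lemma good_adj v j n : v = e j -> good v n.+1 -> adj G (cur v n) (cur v n.+1).
Proof.
move=> vj gv; have nev : cur v n <> v.
  move=> ev; have [_ [_]] := linked_vset (gv _ (leqnn n.+1)).
  by apply; rewrite pastS; right.
by have [i [k [_ [tS _] _]]] := candidate_step vj (good_le (leqnSn n) gv) nev.
Qed.

(* Along the branch towards [e j], the index of the first target never
   decreases; while it stays the same, its distance decreases. *)
Lemma branch_reaches j k d n i : good (e j) n -> cur (e j) n <> e j ->
  first_target (past (e j) n.+1) (e j) i -> j - i = k ->
  (exists y, reach (past (e j) n.+1) (cur (e j) n) (e i) d y) ->
  exists2 m, good (e j) m & cur (e j) m = e j.
Proof.
set v := e j; elim/ltn_ind: k d n i => k IHk.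
elim/ltn_ind => d IHd n i gv nev fi ik [y ry].
have cand := candidate_step erefl gv nev.
have [i0 [m [fi0 [_ wm] mmin]]] := cand.
rewrite (first_target_unique fi0 fi) in wm mmin => {i0 fi0}.
have md := mmin _ _ ry; have gS := good_step erefl gv nev.
have [ev|neS] := pselect (cur v n.+1 = v); first by exists n.+1.
have vv := conn_step (gS _ (leqnn _)) neS.
have [i' fi'] := first_target_exists (erefl v) vv.
have ij : i' <= j by apply: fi'.2.
have : i <= i' by apply: fi.2; apply: conn_past (leqnSn _) fi'.1.
have [i1 [m1 [fi1 r1 _]]] := candidate_step erefl gS neS.
rewrite (first_target_unique fi1 fi') in r1 => {i1 fi1}.
(* A new target has a larger index, still at most [j], so [j - i] drops. *)
rewrite leq_eqVlt => /orP[/eqP ii'|ii']; last first.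
  by apply: (IHk (j - i') _ m1 n.+1 i') => //; [lia | exists (cur v n.+2)].
have [_ [_ nz]] := linked_vset fi'.1; rewrite -ii' in fi' nz.
case: m wm mmin md => [[_ yz]|m [w yw wz]] mmin md.
  by case: nz; rewrite -yz pastS; right.
(* With the same target, minimality keeps the rest of the walk away from the new vertex, and this
   rest is shorter than [d]. *)
have [wz'|[l lm lz]] := walk_avoid (cur v n.+1) wz; last first.
  have ad : adj G (cur v n) (cur v n.+1) by apply: (@good_adj _ j).
  by have := mmin l (cur v n.+1) (conj ad lz); lia.
apply: (IHd m _ n.+1 i) => //; exists w; split=> //; by case: yw.
Qed.

(** * The tree formed by the branches, and its normality *)

Definition dfs_edge x y := exists j n,
  [/\ good (e j) n.+1, cur (e j) n = x & cur (e j) n.+1 = y].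

Definition dfs_vset t := exists j n, good (e j) n /\ cur (e j) n = t.

Definition dfs_adj x y := dfs_edge x y \/ dfs_edge y x.

Definition height t n := good t n /\ cur t n = t.

Lemma height_unique t m n : height t m -> height t n -> m = n.
Proof.
move=> [gm em] [gn en]; case: (ltngtP m n) => // mn.
- by case: (cur_notin_past gn); apply/past_cur; exists m; rewrite ?en.
- by case: (cur_notin_past gm); apply/past_cur; exists n; rewrite ?em.
Qed.

Lemma good_height v n : good v n -> height (cur v n) n.
Proof. by move=> gv; split; [apply: good_cur | rewrite (cur_branch gv)]. Qed.

(** The lower end is read off from the branch of [y] itself, so parents are unique. *)
Lemma dfs_edge_height x y : dfs_edge x y ->
  exists n, [/\ height x n, height y n.+1 & cur y n = x].
Proof.
move=> [j [n [gn <- <-]]]; exists n; split.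
- exact: good_height (good_le (leqnSn n) gn).
- exact: good_height.
- by rewrite (cur_branch gn).
Qed.

Lemma dfs_vset_height t : dfs_vset t -> exists n,
  [/\ height t n, forall i, i <= n -> dfs_vset (cur t i)
    & forall i, i < n -> dfs_edge (cur t i) (cur t i.+1)].
Proof.
move=> [j [n [gn <-]]]; exists n; split=> [|i i_n|i i_n].
- exact: good_height.
- by rewrite (cur_branch gn) //; exists j, i; split=> //; apply: good_le gn.
- rewrite !(cur_branch gn) //; last exact: ltnW.
  by exists j, i; split=> //; apply: good_le gn.
Qed.

Fact dfs_sym x y : dfs_adj x y -> dfs_adj y x.
Proof. by case; [right | left]. Qed.

Lemma dfs_edge_irrefl x : ~ dfs_edge x x.
Proof.
by case/dfs_edge_height => n [h1 h2 _]; have := height_unique h1 h2; lia.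
Qed.

Fact dfs_irrefl x : ~ dfs_adj x x.
Proof. by case=> /dfs_edge_irrefl. Qed.

Fact dfs_adj_vset x y : dfs_adj x y -> dfs_vset x.
Proof.
case=> -[j [n [gn ex ey]]]; last by exists j, n.+1.
by exists j, n; split=> //; apply: good_le gn.
Qed.

Definition dfs_tree : graph V := Graph dfs_sym dfs_irrefl dfs_adj_vset.

Lemma dfs_sub : subgraph dfs_tree G.
Proof.
have sE x y : dfs_edge x y -> adj G x y.
  by move=> [j [n [gn <- <-]]]; apply: (@good_adj _ j).
split=> [_ [j [n [gn <-]]]|x y [/sE//|/sE]]; last exact: adj_sym.
by have [[]] := linked_vset (gn n (leqnn n)).
Qed.

Lemma conn0 u v : vset G u -> vset G v -> conn set0 u v.
Proof.
move=> Gu Gv; apply: linked_mono (connected_linked G_connected Gu Gv).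
by split=> [x Gx|x y xy]; split.
Qed.

Lemma dfs_root : dfs_vset r.
Proof.
exists 0, 0; split=> // i; rewrite leqn0 => /eqP->.
by apply: conn0 => //; apply: e_vset.
Qed.

Lemma dfs_contains j : dfs_vset (e j).
Proof.
suff [n gn en] : exists2 n, good (e j) n & cur (e j) n = e j by exists j, n.
have g0 : good (e j) 0.
  by move=> i; rewrite leqn0 => /eqP->; apply: conn0 => //; apply: e_vset.
have [ev|nev] := pselect (cur (e j) 0 = e j); first by exists 0.
have [i [d [fi rd _]]] := candidate_step erefl g0 nev.
by apply: (branch_reaches g0 nev fi erefl); exists (cur (e j) 1); apply: rd.
Qed.

Lemma dfs_branch_path t n : height t n ->
  (forall i, i < n -> dfs_edge (cur t i) (cur t i.+1)) ->
  dfs_vset t -> is_path dfs_tree (fun i => cur t i) n.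
Proof.
move=> [gn en] te Tt; split=> [i|i j i_n jn|i i_n]; last by left; apply: te.
  rewrite leq_eqVlt => /orP[/eqP->|/te ti]; first by rewrite en.
  by apply: (@dfs_adj_vset _ (cur t i.+1)); left.
have lt_ij a b : a < b -> b <= n -> cur t a <> cur t b.
  move=> ab bn ec; case: (cur_notin_past (good_le bn gn)).
  by apply/past_cur; exists a.
move=> ec; case: (ltngtP i j) => // ij.
- by case: (lt_ij _ _ ij jn).
- by case: (lt_ij _ _ ij i_n).
Qed.

Lemma dfs_connected : connected dfs_tree.
Proof.
suff rt t : dfs_vset t -> linked dfs_tree r t.
  apply: linked_connected; first by exists r; apply: dfs_root.
  move=> u v Tu Tv; exact: linked_trans (linked_sym (rt u Tu)) (rt v Tv).
move=> Tt; have [n [ht _ te]] := dfs_vset_height Tt.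
have pp := dfs_branch_path ht te Tt; have := path_walk pp (leq0n n) (leqnn n).
by rewrite ht.2 => w; exists (n - 0).
Qed.

(* A vertex of maximal height on a cycle would have two distinct parents. *)
Lemma dfs_acyclic : acyclic dfs_tree.
Proof.
move=> p n [n2 [pv pi pe] pc].
have : forall t, exists k, dfs_vset t -> height t k.
  move=> t; have [/dfs_vset_height[k [hk _ _]]|nT] := pselect (dfs_vset t).
    by exists k.
  by exists 0.
case/choice => h hP.
have [m mn mmax] : exists2 m, m <= n & forall i, i <= n -> h (p i) <= h (p m).
  have [k _ kmax] := @arg_maxnP 'I_n.+1 ord0 xpredT (fun i => h (p i)) isT.
  exists k; first by rewrite -ltnS.
  by move=> i i_n; apply: (kmax (Ordinal (i_n : i < n.+1))).
have parent i : i <= n -> adj dfs_tree (p m) (p i) -> p i = cur (p m) (h (p m)).-1.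
  move=> i_n mi; have hi := hP _ (pv _ i_n); have hm := hP _ (pv _ mn).
  case: mi => /dfs_edge_height[k [h1 h2 ec]].
    have := mmax i i_n; rewrite (height_unique hi h2) (height_unique hm h1); lia.
  by rewrite (height_unique hm h2).
have two i j : i <= n -> j <= n -> i <> j ->
    adj dfs_tree (p m) (p i) -> adj dfs_tree (p m) (p j) -> False.
  move=> i_n jn ij /(parent i i_n) ei /(parent j jn) ej; apply: ij.
  by apply: pi; rewrite // ei.
(* The two cycle neighbours of [p m] are compared; for [m] equal to [0] or [n], one of them comes
   from the closing edge. *)
have [m0|m0] := posnP m.
  apply: (two 1 n); rewrite ?m0; [lia | lia | lia | apply: pe; lia | exact: adj_sym].
have [mn'|mn'] := leqP n m.
  have {}mn : m = n by lia.
  apply: (two n.-1 0); rewrite ?mn; [lia | lia | lia | | by []].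
  by apply: adj_sym; have := pe n.-1; rewrite prednK; [apply; lia | lia].
apply: (two m.-1 m.+1); [lia | lia | lia | | exact: pe].
by apply: adj_sym; have := pe m.-1; rewrite prednK //; apply; lia.
Qed.

(** While the branches agree, the vertices passed are tree vertices other than [x] and [y]; deleting
    them leaves [x] and [y] in one component, so the next step agrees too. *)
Lemma dfs_agree x y n m : height x n -> height y m ->
  dfs_vset x -> dfs_vset y ->
  (forall A : set V, A `<=` dfs_vset -> ~ A x -> ~ A y -> conn A x y) ->
  forall k, k <= n -> k <= m -> branch x k = branch y k.
Proof.
move=> hx hy Tx Ty Axy; elim=> [//|k IH] kn km.
apply/esym; have ek := IH (ltnW kn) (ltnW km).
have notin t l : height t l -> k < l -> ~ past t k.+1 t.
  move=> [gl el] kl /past_cur[i ik ei]; apply: (cur_notin_past gl).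
  by apply/past_cur; exists i; [lia | rewrite el].
have xy : conn (past x k.+1) x y.
  apply: Axy; last 1 first.
  - by rewrite pastS ek -pastS; apply: notin km.
  - move=> _ /past_cur[i ik <-]; have [n' [hx' Tx' _]] := dfs_vset_height Tx.
    by apply: Tx'; rewrite -(height_unique hx hx'); lia.
  - exact: notin kn.
exact: branch_agree xy _ (leqnn k.+1).
Qed.

(** The branches of the two ends of a [T]-path agree up to the smaller height, so the lower end lies
    on the branch of the other. *)
Lemma dfs_normal : is_normal_tree G dfs_tree r.
Proof.
split; [split; [split; [exact: dfs_connected | exact: dfs_acyclic] | exact: dfs_root]
  | exact: dfs_sub |].
move=> p k [pp k0 pT _]; have [pv pi pe] := pp.
have T0 : dfs_vset (p 0) by apply/(pT 0) => //; left.
have Tk : dfs_vset (p k) by apply/(pT k) => //; right.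
have [n [h0 T0' e0]] := dfs_vset_height T0; have [m [hk Tk' ek]] := dfs_vset_height Tk.
have agree : forall l, l <= n -> l <= m -> branch (p 0) l = branch (p k) l.
  (* The path meets the tree only in its ends, so it survives the deletion of [A]. *)
  apply: dfs_agree => // A AT A0 Ak; apply: linked_segment => //.
    by split=> //; apply: pv.
  have nA i : i <= k -> ~ A (p i).
    move=> ik Ai; have /(pT i ik)[i0|ik'] := AT _ Ai; first by rewrite i0 in Ai.
    by rewrite ik' in Ai.
  by move=> l _ lk; split; [apply: pe | apply: nA; lia | apply: nA].
have root t : cur t 0 = r by [].
have [nm|/ltnW mn] := leqP n m; [left|right].
  have := tree_le_path (dfs_branch_path hk ek Tk) (root _) nm.
  by rewrite hk.2 -agree // h0.2.
have := tree_le_path (dfs_branch_path h0 e0 T0) (root _) mn.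
by rewrite h0.2 agree // hk.2.
Qed.

Lemma dfs_countable : countable (vset dfs_tree).
Proof.
apply: (@sub_countable _ _ _ ((fun jn => cur (e jn.1) jn.2) @` [set: nat * nat])).
  by apply: subset_card_le => _ [j [n [_ <-]]]; exists (j, n).
by apply: sub_countable (card_image_le _ _) _; apply: countableP.
Qed.

End DepthFirstTree.

(** * Countable normal trees through prescribed vertices, and the equivalence *)

Lemma countable_enumeration (V : Type) (U : set V) v : countable U -> U v ->
  exists2 e : nat -> V, (forall i, U (e i)) & forall x, U x -> exists i, e i = x.
Proof.
move=> /countable_injP[f finj] Uv.
have : forall n, exists x, U x /\ forall y, U y -> f y = n -> y = x.
  move=> n; have [[x [Ux fx]]|none] := pselect (exists x, U x /\ f x = n).
    (* Each index in the image of [f] is sent back to its preimage; the other indices receive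
       [v]. *)
    exists x; split=> // y Uy fy; apply: finj; rewrite ?inE //; congruence.
  by exists v; split=> // y Uy fy; case: none; exists y.
case/choice => e eP; exists e => [i|x Ux]; first by case: (eP i).
by exists (f x); case: (eP (f x)) => _ /(_ x Ux erefl).
Qed.

Lemma normal_tree_containing (V : Type) (G : graph V) (U : set V) :
  connected G -> countable U -> U `<=` vset G ->
  exists T r, [/\ is_normal_tree G T r, countable (vset T) & U `<=` vset T].
Proof.
move=> cG cU UG; have [[r Gr] _] := cG.
have [||e eU Ue] := @countable_enumeration _ (U `|` [set r]) r.
- by apply: countableU => //; apply: countable1.
- by right.
have eG i : vset G (e i) by case: (eU i) => [/UG//|->].
exists (dfs_tree G e r), r; split; first exact: dfs_normal.
- exact: dfs_countable.
- by move=> x Ux; have [|i <-] := Ue x; [left | apply: dfs_contains].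
Qed.

Theorem theorem3 (V : Type) (G : graph V) (hG : connected G) :
  countably_determined G <->
  exists (T : graph V) (r : V),
    [/\ is_normal_tree G T r,
        countable (vset T)
      & forall w : set (nat -> V), is_end G w ->
          exists2 q : nat -> V, w q & is_ray T q].
Proof.
split; last by move=> [T [r [nT cT ends]]]; apply: tree_countably_determined nT cT ends.
move=> [D [cD _ distD]].
have [||T0 [r0 [nT0 cT0 DT0]]] :=
    @normal_tree_containing _ G (\bigcup_(c in D) fset_of c.1) hG.
- by apply: bigcup_countable => // c _; apply/finite_set_countable/finvset_finite.
- by move=> x [c _ cx]; apply: finvset_sub cx.
have {}DT0 c : D c -> c.1 `<=` vset T0 by move=> Dc x cx; apply: DT0; exists c.
have [W cW rayW] := countable_ray_cover distD cD cT0 DT0.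
(* [T] receives the vertices of the chosen rays but perhaps not their edges, so rays of [T] itself
   must be found through normality. *)
have [||T [r [nT cT UT]]] := @normal_tree_containing _ G (vset T0 `|` (W `&` vset G)) hG.
- apply: countableU => //; apply: sub_countable cW.
  by apply: subset_card_le => x [].
- by case: nT0 => _ [sV _] _; rewrite subUset; split=> // x [].
exists T, r; split=> // w [R rR ->].
have [f [df Rf]] := ray_dir_exists rR.
have ray_in q X : is_ray G q -> ray_dir q f -> (forall i, vset T (q i)) ->
    exists2 v, vset T v & vset (f X) v.
  by move=> qG qf qT; have [N fN] := qf X; exists (q N) => //; apply: fN.
have [q qT qf] : exists2 q, is_ray T q & ray_dir q f.
  (* It remains that every [f X] meets [T]. A ray of direction [f] with its vertices in [T] shows
     this: it comes from [T0] if [f] meets [T0] outside every finite subset of [T0], and from [W]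
     otherwise. *)
  apply: (direction_in_tree distD nT) => //.
    by move=> c /DT0 cT0' x /cT0' Tx; apply: UT; left.
  move=> X _; have [meets|] := pselect (forall Y : finvset G, Y `<=` vset T0 ->
      exists2 v, vset T0 v & vset (f Y) v).
    have [q qT0 qf] := direction_in_tree distD nT0 DT0 df meets.
    apply: (ray_in q) => // [|i]; last by apply: UT; left; apply: ray_vset.
    by case: nT0 => _ sT0 _; apply: ray_mono sT0 qT0.
  move=> /existsNP[Y /not_implyP[YT0 none]].
  have missY : misses (vset T0) f Y by move=> v fv Tv; apply: none; exists v.
  have [q [qG qf qW]] := rayW f Y df YT0 missY.
  apply: (ray_in q) => // i; apply: UT; right; split; last exact: ray_vset.
  by apply: qW; exists i.
have [_ sT _] := nT; have qG := ray_mono sT qT.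
by exists q => //; split=> //; apply: ray_dir_equiv Rf qf.
Qed.
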